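(* Let $\varepsilon>0$. For $x>0$, $t>0$ and $n=1,2,3,\ldots$ let $$u_n(x,t):=\frac{\partial^n v(x,t)}{\partial t^n},\qquad v(x,t)=-\frac{3}{2\pi i}\int_{\operatorname{Im}\lambda=\varepsilon}e^{i\lambda x+i\lambda^3t}\,\frac{d\lambda}{\lambda}.$$ Then $$u_n(x,t)=-\frac{3}{2\pi}\int_{\operatorname{Im}\lambda=\varepsilon}(i\lambda^3)^{n-1}e^{i\lambda x+i\lambda^3t}\lambda^2\,d\lambda,$$ and each $u=u_n$ solves the initial-boundary-value problem $$u_t=-u_{xxx}\ (x>0,\ t>0),\qquad \lim_{x\to0^+}u(x,t)=0\ (t>0),\qquad \lim_{t\to0^+}u(x,t)=0\ (x>0).$$ Moreover $u_1\not\equiv0$.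
   Context: The line $\{\operatorname{Im}\lambda=\varepsilon\}$ is oriented from left to right (increasing $\operatorname{Re}\lambda$). The integral defining $v$ does not depend on the choice of $\varepsilon>0$. *)

(* Defs.v *)
From HB Require Import structures.
From mathcomp Require Import all_boot all_order all_algebra.
From mathcomp Require Import complex.
From mathcomp Require Import all_classical all_reals all_analysis.
Set Implicit Arguments.
Unset Strict Implicit.
Unset Printing Implicit Defensive.
Import Order.TTheory GRing.Theory Num.Theory.
Import numFieldNormedType.Exports.

Local Open Scope ring_scope.
Local Open Scope complex_scope.
Local Open Scope classical_set_scope.

(* [Rcomplex R] is the type [R[i]] seen as an R-module, with the modulus as its
   R-valued norm. Equipping it with the topology of that norm makes it a
   [normedModType R], so that [derivable], [derive1n] and [-->] apply to
   complex-valued functions of a real variable. *)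
HB.instance Definition _ (R : realType) :=
  PseudoMetric.copy (Rcomplex R) (pseudoMetric_normed (Rcomplex R)).
HB.instance Definition _ (R : realType) := isPointed.Build (Rcomplex R) 0.
HB.instance Definition _ (R : realType) :=
  NormedZmod_PseudoMetric_eq.Build R (Rcomplex R) erefl.

Fact Rcomplex_normrZ (R : realType) (l : R) (z : Rcomplex R) :
  `|l *: z| = `|l| * `|z|.
Proof.
case: z => a b; rewrite -[LHS]/(Num.sqrt ((l * a) ^+ 2 + (l * b) ^+ 2)).
rewrite -[`|a +i* b : Rcomplex R|]/(Num.sqrt (a ^+ 2 + b ^+ 2)).
by rewrite !exprMn -mulrDr sqrtrM ?sqr_ge0// sqrtr_sqr.
Qed.

HB.instance Definition _ (R : realType) :=
  PseudoMetricNormedZmod_Lmodule_isNormedModule.Build R (Rcomplex R)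
    (@Rcomplex_normrZ R).

Definition cexp (R : realType) (z : R[i]) : R[i] :=
  (expR (complex.Re z))%:C * (cos (complex.Im z) +i* sin (complex.Im z)).

(* Integrals over the line Im z = eps, oriented by increasing real part, in the
   parametrization s |-> s + i eps, for which dz = ds. *)
Definition line_integrable (R : realType) (eps : R) (f : R[i] -> R[i]) : Prop :=
  (@lebesgue_measure R).-integrable setT
    (fun s : R => (complex.Re (f (s +i* eps)))%:E) /\
  (@lebesgue_measure R).-integrable setT
    (fun s : R => (complex.Im (f (s +i* eps)))%:E).

Definition line_integral (R : realType) (eps : R) (f : R[i] -> R[i]) : R[i] :=
  (\int[@lebesgue_measure R]_s complex.Re (f (s +i* eps))) +i*
  (\int[@lebesgue_measure R]_s complex.Im (f (s +i* eps))).

(* [derive1n k f] is total: [derivable_upto n A f] says that the derivatives of f of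
   order at most n exist at every point of A. It is meant for A open. *)
Definition derivable_upto (R : realType) (V : normedModType R) (n : nat)
    (A : set R) (f : R -> V) : Prop :=
  forall k : nat, (k < n)%N -> forall a : R, A a -> derivable (derive1n k f) a 1.

(* e^{i z x + i z^3 t} *)
Definition phase (R : realType) (x t : R) (z : R[i]) : R[i] :=
  cexp ('i%C * z * x%:C + 'i%C * z ^+ 3 * t%:C).

Definition v (R : realType) (eps x t : R) : R[i] :=
  - (3 / (2 * pi%:C * 'i%C)) * line_integral eps (fun z => phase x t z / z).

Definition u (R : realType) (eps : R) (n : nat) (x t : R) : Rcomplex R :=
  derive1n n (v eps x : R -> Rcomplex R) t.

Definition solves_ibvp (R : realType) (w : R -> R -> Rcomplex R) : Prop :=
  [/\ forall x t : R, 0 < x -> 0 < t -> derivable (w x) t 1,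
      forall t : R, 0 < t ->
        derivable_upto 3 [set x | 0 < x] (fun x => w x t),
      forall x t : R, 0 < x -> 0 < t ->
        derive1 (w x) t = - derive1n 3 (fun y => w y t) x,
      forall t : R, 0 < t -> w x t @[x --> 0^'+] --> (0 : Rcomplex R) &
      forall x : R, 0 < x -> w x t @[t --> 0^'+] --> (0 : Rcomplex R)].

(* Main.v *)
Require Import Defs.
From HB Require Import structures.
From mathcomp Require Import all_boot all_order all_algebra.
From mathcomp Require Import complex.
From mathcomp Require Import all_classical all_reals all_analysis.
From mathcomp Require Import measurable_realfun ring lra zify.
Set Implicit Arguments.
Unset Strict Implicit.
Unset Printing Implicit Defensive.
Import Order.TTheory GRing.Theory Num.Theory.
Import numFieldNormedType.Exports.

Local Open Scope ring_scope.
Local Open Scope complex_scope.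
Local Open Scope classical_set_scope.

(* On Im z = eta, z = s + i eta, the modulus of e^(izx + i z^3 t) is
   exp (- eta x + t eta^3 - 3 eta t s^2), so for t > 0 every moment
   J_m(x, t) = int z^m e^(izx + i z^3 t) dz converges locally uniformly in
   (x, t, eta) and may be differentiated under the integral sign:
   d/dt J_m = i J_(m+3) and d/dx J_m = i J_(m+1); in particular
   d/dt = - d^3/dx^3 since i^3 = - i. Differentiating in eta gives i times the
   integral of a total s-derivative, so J_m does not depend on eta.
   - At x = 0, J_2 is the integral of a total derivative, hence J_2(0, t) = 0 and,
     by t-derivation, J_(3k+2)(0, t) = 0.
   - For t -> 0, the choice eta = sqrt (x / 2) / sqrt t makes the integrand of
     size exp (- c / sqrt t) up to powers of t.
   - On the line through the saddle point, x = eta and t = 1 / (3 eta), the leading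
     term of - Re J_2 for large eta is a positive multiple of
     eta^2 int e^(- s^2) ds, so J_2 does not vanish identically. *)

Import Normc.

(** * Complex-valued functions of a real variable *)

Section complex_valued_functions.
Context {R : realType}.
Implicit Types (f g : R -> Rcomplex R) (z : R[i]) (x : R).

Lemma normc_ge0 z : 0 <= normc z.
Proof. by case: z => a b; exact: sqrtr_ge0. Qed.

Lemma Re_mulc z1 z2 : complex.Re (z1 * z2) =
  complex.Re z1 * complex.Re z2 - complex.Im z1 * complex.Im z2.
Proof. by case: z1 z2 => [? ?] []. Qed.

Lemma Im_mulc z1 z2 : complex.Im (z1 * z2) =
  complex.Re z1 * complex.Im z2 + complex.Im z1 * complex.Re z2.
Proof. by case: z1 z2 => [? ?] []. Qed.

Lemma abs_Re_le_normc z : `|complex.Re z| <= normc z.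
Proof.
by case: z => a b /=; rewrite -sqrtr_sqr ler_wsqrtr// lerDl sqr_ge0.
Qed.

Lemma abs_Im_le_normc z : `|complex.Im z| <= normc z.
Proof.
by case: z => a b /=; rewrite -sqrtr_sqr ler_wsqrtr// lerDr sqr_ge0.
Qed.

Lemma normc_le_abs_ReIm z : normc z <= `|complex.Re z| + `|complex.Im z|.
Proof.
case: z => a b /=; rewrite -[leRHS]ger0_norm ?addr_ge0//.
rewrite -sqrtr_sqr ler_wsqrtr// sqrrD !real_normK ?num_real//.
by rewrite lerD2r lerDl mulrn_wge0 ?mulr_ge0.
Qed.

(** Each coordinate is bounded by the modulus, and the modulus by the sum of the absolute values of
    the coordinates. This reduces limits and derivatives to the real-valued case. *)
Lemma cvg_RcomplexP {T : Type} {F : set_system T} {FF : Filter F}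
    (f : T -> Rcomplex R) (l : Rcomplex R) :
  f @ F --> l <-> complex.Re (f t) @[t --> F] --> complex.Re l /\
                  complex.Im (f t) @[t --> F] --> complex.Im l.
Proof.
split.
  move=> /cvgrPdist_lt fl; split; apply/cvgrPdist_lt => e e0;
    have := fl _ e0; apply: filterS => t.
    by apply: le_lt_trans; rewrite -(raddfB (@complex.Re R)) abs_Re_le_normc.
  by apply: le_lt_trans; rewrite -(raddfB (@complex.Im R)) abs_Im_le_normc.
move=> [/cvgrPdist_lt fr /cvgrPdist_lt fi]; apply/cvgrPdist_lt => e e0.
have e20 : 0 < e / 2 by rewrite divr_gt0.
have := fi _ e20; have := fr _ e20; apply: filterS2 => t h1 h2.
rewrite [e]splitr; apply: le_lt_trans (ltrD h1 h2).
by rewrite -(raddfB (@complex.Re R)) -(raddfB (@complex.Im R)) normc_le_abs_ReIm.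
Qed.

Lemma cvg_mulcl {T : Type} {F : set_system T} {FF : Filter F} (c : Rcomplex R)
    (f : T -> Rcomplex R) (l : Rcomplex R) :
  f @ F --> l -> (c * f y : Rcomplex R) @[y --> F] --> c * l.
Proof.
move=> /cvg_RcomplexP[fr fi]; apply/cvg_RcomplexP.
split.
  rewrite Re_mulc; under eq_fun do rewrite Re_mulc.
  by apply: cvgB; apply: cvgMr => //; exact: cvg_cst.
rewrite Im_mulc; under eq_fun do rewrite Im_mulc.
by apply: cvgD; apply: cvgMr => //; exact: cvg_cst.
Qed.

Lemma is_derive_cvgP (V W : normedModType R) (f : V -> W) (a v : V) (df : W) :
  is_derive a v f df <->
  h^-1 *: ((f \o shift a) (h *: v) - f a) @[h --> 0^'] --> df.
Proof.
split=> [[+ <-]|fdf].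
  by move/cvg_ex => [l fl]; rewrite /derive (cvg_lim _ fl).
by apply: DeriveDef; [apply/cvg_ex; exists df|exact/cvg_lim].
Qed.

Lemma is_derive_RcomplexP f x (d : Rcomplex R) :
  is_derive x 1 f d <->
  is_derive x 1 (fun y => complex.Re (f y)) (complex.Re d) /\
  is_derive x 1 (fun y => complex.Im (f y)) (complex.Im d).
Proof.
rewrite !is_derive_cvgP cvg_RcomplexP.
have eRe (h : R) (a b : Rcomplex R) :
    complex.Re (h *: (a - b)) = h *: (complex.Re a - complex.Re b).
  by case: a b => [? ?] [].
have eIm (h : R) (a b : Rcomplex R) :
    complex.Im (h *: (a - b)) = h *: (complex.Im a - complex.Im b).
  by case: a b => [? ?] [].
under eq_cvg do rewrite eRe.
by under [X in _ /\ X <-> _]eq_cvg do rewrite eIm.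
Qed.

End complex_valued_functions.

Section complex_derivatives.
Context {R : realType}.
Implicit Types (f g : R -> Rcomplex R) (x : R).

Let is_deriveM_fun (h k : R -> R) x (dh dk : R) :
  is_derive x 1 h dh -> is_derive x 1 k dk ->
  is_derive x 1 (fun y => h y * k y) (dh * k x + h x * dk).
Proof.
move=> hx kx; have H := is_deriveM hx kx.
apply: (is_derive_eq H).
by rewrite /GRing.scale /= addrC mulrC.
Qed.

Lemma is_derive_addc f g x (df dg : Rcomplex R) :
  is_derive x 1 f df -> is_derive x 1 g dg ->
  is_derive x 1 (fun y => f y + g y : Rcomplex R) (df + dg).
Proof. exact: is_deriveD. Qed.

(** The product is that of [R[i]]: its coordinates are bilinear in those of the factors, so the real
    product rule applies to each. *)
Lemma is_derive_mulc f g x (df dg : Rcomplex R) :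
  is_derive x 1 f df -> is_derive x 1 g dg ->
  is_derive x 1 (fun y => f y * g y : Rcomplex R) (df * g x + f x * dg).
Proof.
move=> /is_derive_RcomplexP[fr fi] /is_derive_RcomplexP[gr gi].
apply/is_derive_RcomplexP.
split.
  under eq_fun do rewrite Re_mulc.
  apply: (is_derive_eq (is_deriveB (is_deriveM_fun fr gr) (is_deriveM_fun fi gi))).
  by case: df dg (f x) (g x) {fr fi gr gi} => [? ?] [? ?] [? ?] [? ?] /=; ring.
under eq_fun do rewrite Im_mulc.
apply: (is_derive_eq (is_deriveD (is_deriveM_fun fr gi) (is_deriveM_fun fi gr))).
by case: df dg (f x) (g x) {fr fi gr gi} => [? ?] [? ?] [? ?] [? ?] /=; ring.
Qed.

Lemma is_derive_mulcl (c : Rcomplex R) f x (df : Rcomplex R) :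
  is_derive x 1 f df -> is_derive x 1 (fun y => c * f y : Rcomplex R) (c * df).
Proof.
move=> fx; have := is_derive_mulc (is_derive_cst c x 1) fx.
by rewrite mul0r add0r.
Qed.

Lemma is_derive_expc f n x (df : Rcomplex R) : is_derive x 1 f df ->
  is_derive x 1 (fun y => f y ^+ n : Rcomplex R) (n%:R * f x ^+ n.-1 * df).
Proof.
move=> fx; elim: n => [|n IH].
  by rewrite mul0r mul0r; exact: is_derive_cst.
under eq_fun do rewrite exprS.
apply: (is_derive_eq (is_derive_mulc fx IH)).
(* For [n = 0] the truncated exponent [n.-1] breaks f * f^(n-1) = f^n, but the coefficient 0 removes
   that term. *)
case: n {IH} => [|n] /=; first by rewrite expr0 !mul0r mulr0 addr0 mulr1 !mul1r.
rewrite -[n.+2]addn1 natrD exprS; ring.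
Qed.

Lemma is_derive_real_complex (h : R -> R) x dh : is_derive x 1 h dh ->
  is_derive x 1 (fun y => (h y)%:C : Rcomplex R) dh%:C.
Proof. by move=> ?; apply/is_derive_RcomplexP; split => //=; exact: is_derive_cst. Qed.

Lemma cexpE (z : R[i]) : cexp z =
  (expR (complex.Re z) * cos (complex.Im z)) +i*
  (expR (complex.Re z) * sin (complex.Im z)).
Proof.
by rewrite /cexp; case: z => a b /=; congr (_ +i* _); rewrite !mul0r (subr0, addr0).
Qed.

Lemma normc_cexp (z : R[i]) : normc (cexp z) = expR (complex.Re z).
Proof.
rewrite cexpE /= !exprMn -mulrDr cos2Dsin2 mulr1 sqrtr_sqr.
by rewrite ger0_norm ?expR_ge0.
Qed.

Lemma is_derive_cexp f x (df : Rcomplex R) : is_derive x 1 f df ->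
  is_derive x 1 (fun y => cexp (f y) : Rcomplex R) (df * cexp (f x)).
Proof.
move=> /is_derive_RcomplexP[fr fi].
have e := is_derive1_comp (is_derive_expR (complex.Re (f x))) fr.
have c := is_derive1_comp (is_derive_cos (complex.Im (f x))) fi.
have s := is_derive1_comp (is_derive_sin (complex.Im (f x))) fi.
apply/is_derive_RcomplexP; split.
  under eq_fun do rewrite cexpE /=.
  apply: (is_derive_eq (is_deriveM_fun e c)).
  rewrite cexpE; case: df {fr fi e c s} => a b /=.
  ring.
under eq_fun do rewrite cexpE /=.
apply: (is_derive_eq (is_deriveM_fun e s)).
rewrite cexpE; case: df {fr fi e c s} => a b /=.
ring.
Qed.

Lemma is_derive_line_Re (eta x : R) :
  is_derive x 1 (fun s => s +i* eta : Rcomplex R) 1.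
Proof.
by apply/is_derive_RcomplexP; split; [exact: is_derive_id|exact: is_derive_cst].
Qed.

Lemma is_derive_line_Im (s x : R) :
  is_derive x 1 (fun eta => s +i* eta : Rcomplex R) 'i%C.
Proof.
by apply/is_derive_RcomplexP; split; [exact: is_derive_cst|exact: is_derive_id].
Qed.

End complex_derivatives.

(** * Integration over the real line *)

Section integrals_over_the_line.
Context {R : realType}.
Let mu := @lebesgue_measure R.
Local Notation lorentz := (fun s : R => (oneDsqr s)^-1).

(** The function 1 / (1 + s^2) is the common dominating function of what follows. It is even, and
    its integral over the half-line is finite. *)
Lemma integrable_oneDsqrV : mu.-integrable setT (EFin \o lorentz).
Proof.
have mf : measurable_fun [set: R] lorentz.
  by apply: continuous_measurable_fun; exact: continuous_oneDsqrV.
apply/integrableP; split; first exact/measurable_EFinP.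
apply/abse_integralP => //; first exact/measurable_EFinP.
rewrite /comp ge0_symfun_integralT//.
- rewrite (_ : [set x | _] = `[0, +oo[%classic); last first.
    by apply/seteqP; split => x/=; rewrite in_itv/= andbT.
  by rewrite integral0y_oneDsqr -EFinM/= ltry.
- exact: continuous_oneDsqrV.
- by move=> x /=; rewrite /oneDsqr sqrrN.
Qed.

(** The fundamental theorem on [- n, n] leaves f(n) - f(- n), which tends to 0, while dominated
    convergence, with |df| dominating, sends these integrals to the one over the whole line. *)
Lemma integral_derive_eq0 (f df : R -> R) :
  (forall x : R, is_derive x 1 f (df x)) -> continuous df ->
  mu.-integrable setT (EFin \o df) ->
  f n%:R @[n --> \oo] --> 0 -> f (- n%:R) @[n --> \oo] --> 0 ->
  \int[mu]_x df x = 0.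
Proof.
move=> fdf cdf idf f0 fN0.
have cf : continuous f.
  move=> x; apply/differentiable_continuous/derivable1_diffP.
  by have [] := fdf x.
pose I (n : nat) : set R := `[- n%:R, n%:R].
have FTC n : (0 < n)%N -> (\int[mu]_(x in I n) (df x)%:E = (f n%:R - f (- n%:R))%:E)%E.
  move=> n0; rewrite (@continuous_FTC2 _ df f) ?EFinB//.
  - by rewrite gtrN// ltr0n.
  - exact: continuous_subspaceT.
  - split; first by move=> x _; have [] := fdf x.
      by apply: cvg_at_right_filter; exact: cf.
    by apply: cvg_at_left_filter; exact: cf.
  - by move=> x _; rewrite derive1E; exact: derive_val.
have mdf : measurable_fun setT df by exact: continuous_measurable_fun.
have h : (\int[mu]_x ((EFin \o df) \_ (I n)) x @[n --> \oo] -->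
    \int[mu]_x (df x)%:E)%E.
  apply: (@dominated_cvg _ _ _ mu setT measurableT _ (EFin \o df)
      (fun x => `|(df x)%:E|%E)).
  - move=> n; apply/(measurable_restrictT _ _).1 => //; first exact: measurable_itv.
    by apply/measurable_EFinP; exact: measurable_funTS.
  - move=> x _; apply: cvg_near_cst; near=> n.
    rewrite /= patchE mem_set// /I /= in_itv/=.
    rewrite -ler_norml.
    by near: n; exact: nbhs_infty_ger.
  - by [].
  - exact: integrable_abse.
  - move=> n x _; rewrite patchE; case: ifPn => //= _.
    by rewrite normr0 lee_fin.
have : (\int[mu]_x (df x)%:E = 0)%E.
  apply: (cvg_unique _ h) => //.
  apply: (@cvg_trans _ ((f n%:R - f (- n%:R))%:E @[n --> \oo])).
    apply: near_eq_cvg; near=> n.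
    rewrite -integral_mkcond FTC//.
    by near: n; exact: nbhs_infty_gt.
  apply: cvg_EFin; first exact: nearW.
  rewrite -[X in _ --> X](subr0 0).
  exact: cvgB.
by rewrite /Rintegral => ->.
Unshelve. all: by end_near. Qed.

End integrals_over_the_line.

Section Rcomplex_integrals.
Context {R : realType}.
Let mu := @lebesgue_measure R.
Implicit Types F : R -> Rcomplex R.

(** The integrand depends on the real parameter, so that the line itself may move. At
    [f (s +i* eps)] this and [Rcomplex_integral] unfold to [line_integrable] and [line_integral]. *)
Definition Rcomplex_integrable F : Prop :=
  mu.-integrable setT (fun s => (complex.Re (F s))%:E) /\
  mu.-integrable setT (fun s => (complex.Im (F s))%:E).

Definition Rcomplex_integral F : Rcomplex R :=
  (\int[mu]_s complex.Re (F s)) +i* (\int[mu]_s complex.Im (F s)).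

Lemma continuous_RcomplexP F : continuous F <->
  continuous (fun s => complex.Re (F s)) /\
  continuous (fun s => complex.Im (F s)).
Proof.
split=> [cF|[cr ci] s]; last by apply/cvg_RcomplexP; split; [exact: cr|exact: ci].
by split=> s; have /cvg_RcomplexP[] := cF s.
Qed.

Lemma integrable_le_oneDsqrV (f : R -> R) (M : R) : continuous f ->
  (forall s, `|f s| <= M / oneDsqr s) -> mu.-integrable setT (EFin \o f).
Proof.
move=> cf fM.
apply: (@le_integrable _ _ _ mu setT measurableT _ (fun s => (M%:E * (oneDsqr s)^-1%:E)%E)).
- by apply/measurable_EFinP; exact: continuous_measurable_fun.
- by move=> s _; rewrite -EFinM lee_fin (le_trans (fM s))// ler_norm.
- by apply: integrableZl => //; exact: integrable_oneDsqrV.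
Qed.

Lemma Rcomplex_integrable_le F (M : R) : continuous F ->
  (forall s, normc (F s) <= M / oneDsqr s) -> Rcomplex_integrable F.
Proof.
move=> /continuous_RcomplexP[cr ci] FM.
by split; apply: integrable_le_oneDsqrV => // s; apply: le_trans (FM s);
  [exact: abs_Re_le_normc|exact: abs_Im_le_normc].
Qed.

Lemma Rcomplex_integralZl F (c : Rcomplex R) : Rcomplex_integrable F ->
  Rcomplex_integral (fun s => c * F s) = c * Rcomplex_integral F.
Proof.
move=> [ir ii].
have iZ (k : R) (f : R -> R) : mu.-integrable setT (fun s => (f s)%:E) ->
    mu.-integrable setT (EFin \o (fun s => k * f s)).
  move=> h; rewrite /comp; under eq_fun do rewrite EFinM.
  exact: integrableZl.
rewrite /Rcomplex_integral.
under eq_Rintegral do rewrite Re_mulc.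
under [X in _ +i* X]eq_Rintegral do rewrite Im_mulc.
rewrite RintegralB//; [|exact: iZ..].
rewrite RintegralD//; [|exact: iZ..].
by rewrite !RintegralZl//; case: c.
Qed.

Lemma Rcomplex_integrableZl F (c : Rcomplex R) : Rcomplex_integrable F ->
  Rcomplex_integrable (fun s => c * F s).
Proof.
move=> [ir ii].
have iZ (k : R) (f : R -> R) : mu.-integrable setT (fun s => (f s)%:E) ->
    mu.-integrable setT (fun s => (k * f s)%:E).
  move=> h; under eq_fun do rewrite EFinM.
  exact: integrableZl.
split.
  under eq_fun do rewrite Re_mulc EFinB.
  by apply: integrableB => //; exact: iZ.
under eq_fun do rewrite Im_mulc EFinD.
by apply: integrableD => //; exact: iZ.
Qed.

Let is_derive_Rintegral (f df : R -> R -> R) (a b x M : R) :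
  a < x < b ->
  (forall y, a < y < b -> mu.-integrable setT (EFin \o f y)) ->
  (forall y s, a < y < b -> is_derive y 1 (f ^~ s) (df y s)) ->
  (forall y s, a < y < b -> `|df y s| <= M / oneDsqr s) ->
  is_derive x 1 (fun y => \int[mu]_s f y s) (\int[mu]_s df x s).
Proof.
move=> xab intf fdf dfM.
have d1 y s : a < y < b -> partial1of2 f y s = df y s.
  by move=> yab; rewrite partial1of2E; have [] := fdf y s yab.
(* The bound at [s = 0] forces the constant to be nonnegative. *)
have M0 : 0 <= M.
  have := le_trans (normr_ge0 _) (dfM x 0 xab).
  by rewrite pmulr_lge0// invr_gt0 (lt_le_trans ltr01).
have G0 s : 0 <= M / oneDsqr s by rewrite divr_ge0// (le_trans ler01).
have intG : mu.-integrable setT (EFin \o (fun s => M / oneDsqr s)).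
  rewrite /comp; under eq_fun do rewrite EFinM.
  by apply: integrableZl => //; exact: integrable_oneDsqrV.
have Iab y : `]a, b[%classic y -> a < y < b by rewrite /= in_itv.
have df1 y s : `]a, b[%classic y -> setT s -> derivable (f ^~ s) y 1.
  by move=> /Iab yab _; have [] := fdf y s yab.
have ub y s : `]a, b[%classic y -> setT s -> `|partial1of2 f y s| <= M / oneDsqr s.
  by move=> /Iab yab _; rewrite d1// dfM.
have xI : `]a, b[%classic x by rewrite /= in_itv.
have intI y : `]a, b[%classic y -> mu.-integrable setT (EFin \o f y).
  by move=> /Iab; exact: intf.
have [H1 H2] := (derivable_under_integral measurableT xI intI df1 G0 intG ub,
  differentiation_under_integral measurableT xI intI df1 G0 intG ub).
apply: DeriveDef => //.
rewrite -derive1E H2; apply: eq_Rintegral => s _; exact: d1.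
Qed.

(** Differentiation under the integral sign, coordinate by coordinate: [M] is common to all [y] in
    the interval, so M / (1 + s^2) dominates uniformly. *)
Lemma is_derive_Rcomplex_integral (F dF : R -> R -> Rcomplex R) (a b x M : R) :
  a < x < b ->
  (forall y, a < y < b -> Rcomplex_integrable (F y)) ->
  (forall y s, a < y < b -> is_derive y 1 (F ^~ s) (dF y s)) ->
  (forall y s, a < y < b -> normc (dF y s) <= M / oneDsqr s) ->
  is_derive x 1 (fun y => Rcomplex_integral (F y)) (Rcomplex_integral (dF x)).
Proof.
move=> xab iF FdF dFM; apply/is_derive_RcomplexP; split.
- apply: (@is_derive_Rintegral (fun y s => complex.Re (F y s))
    (fun y s => complex.Re (dF y s)) a b x M) => // [y yab|y s yab|y s yab].
  + by have [] := iF y yab.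
  + by have /is_derive_RcomplexP[] := FdF y s yab.
  + exact: le_trans (abs_Re_le_normc _) (dFM _ _ yab).
- apply: (@is_derive_Rintegral (fun y s => complex.Im (F y s))
    (fun y s => complex.Im (dF y s)) a b x M) => // [y yab|y s yab|y s yab].
  + by have [] := iF y yab.
  + by have /is_derive_RcomplexP[] := FdF y s yab.
  + exact: le_trans (abs_Im_le_normc _) (dFM _ _ yab).
Qed.

(** Since n + 1 <= 1 + n^2, the bound at n and at - n is at most M / (n + 1). *)
Let cvg_le_oneDsqrV (f : R -> R) (M : R) : (forall s, `|f s| <= M / oneDsqr s) ->
  f n%:R @[n --> \oo] --> 0 /\ f (- n%:R) @[n --> \oo] --> 0.
Proof.
move=> fM.
have M0 : 0 <= M.
  have := le_trans (normr_ge0 _) (fM 0).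
  by rewrite pmulr_lge0// invr_gt0 (lt_le_trans ltr01).
have Mh : M * (n.+1%:R : R)^-1 @[n --> \oo] --> 0.
  by rewrite -[X in _ --> X](mulr0 M); apply: cvgM; [exact: cvg_cst|exact: cvg_harmonic].
have le n : M / oneDsqr n%:R <= M * (n.+1%:R : R)^-1.
  rewrite ler_wpM2l// lef_pV2 ?posrE ?ltr0n ?(lt_le_trans ltr01)//.
  rewrite /oneDsqr -natr1 addrC lerD2l -natrX ler_nat.
  by case: n => // n; rewrite leq_pmulr.
have h (e : R) : 0 < e -> \forall n \near \oo, M * (n.+1%:R : R)^-1 < e.
  by move=> e0; exact: cvgr_lt Mh _ e0.
split; apply/cvgrPdist_lt => e /h; apply: filterS => n; apply: le_lt_trans;
  rewrite sub0r normrN; apply: le_trans (fM _) _ => //.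
by rewrite /oneDsqr sqrrN; exact: le.
Qed.

(** The bound on [F] makes the boundary terms vanish; the bound on [dF] gives integrability. *)
Lemma Rcomplex_integral_derive_eq0 F (dF : R -> Rcomplex R) (M : R) :
  (forall x : R, is_derive x 1 F (dF x)) -> continuous dF ->
  (forall s, normc (F s) <= M / oneDsqr s) ->
  (forall s, normc (dF s) <= M / oneDsqr s) ->
  Rcomplex_integral dF = 0.
Proof.
move=> FdF cdF FM dFM; rewrite /Rcomplex_integral.
have [ir ii] := Rcomplex_integrable_le cdF dFM.
have [cr ci] := (continuous_RcomplexP dF).1 cdF.
have [Fr1 Fr2] := cvg_le_oneDsqrV (fun s => le_trans (abs_Re_le_normc _) (FM s)).
have [Fi1 Fi2] := cvg_le_oneDsqrV (fun s => le_trans (abs_Im_le_normc _) (FM s)).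
rewrite -[RHS]/(0 +i* 0); congr (_ +i* _).
  apply: (@integral_derive_eq0 R (fun s => complex.Re (F s))) => // x.
  by have /is_derive_RcomplexP[] := FdF x.
apply: (@integral_derive_eq0 R (fun s => complex.Im (F s))) => // x.
by have /is_derive_RcomplexP[] := FdF x.
Qed.

End Rcomplex_integrals.

(** * The kernel [z^m e^(izx + i z^3 t)] on a horizontal line *)

Section phase_kernel.
Context {R : realType}.
Implicit Types (x t eta s : R) (z : R[i]) (m : nat).

Lemma normcX z m : normc (z ^+ m) = normc z ^+ m.
Proof.
by elim: m => [|m IH]; rewrite ?expr0 ?normc1// !exprS normcM IH.
Qed.

Lemma Re_phase_exponent x t s eta :
  complex.Re ('i%C * (s +i* eta) * x%:C + 'i%C * (s +i* eta) ^+ 3 * t%:C) =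
  - eta * x + t * eta ^+ 3 - 3 * eta * t * s ^+ 2.
Proof. by rewrite !exprS expr0 /=; ring. Qed.

Lemma normc_phase x t s eta : normc (phase x t (s +i* eta)) =
  expR (- eta * x + t * eta ^+ 3 - 3 * eta * t * s ^+ 2).
Proof. by rewrite normc_cexp Re_phase_exponent. Qed.

(** The quotient y^k / k! is one term of the series of e^y. The estimate trades exponential decay
    for any power that is needed. *)
Lemma expRN_le_Vexpn (y : R) (k : nat) : 0 < y -> expR (- y) <= k`!%:R / y ^+ k.
Proof.
move=> y0; have yk0 : 0 < y ^+ k by rewrite exprn_gt0.
rewrite expRN -[leRHS]invf_div lef_pV2 ?posrE ?expR_gt0 ?divr_gt0 ?ltr0n ?fact_gt0//.
case: k yk0 => [|k] _; last first.
  by apply: le_trans (expR_ge1Dxn k (ltW y0)); rewrite lerDr.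
by rewrite expr0 fact0 divr1 -expR0 ler_expR ltW.
Qed.

(** With B = (1 + eta^2) (1 + s^2) >= 1, the squared modulus s^2 + eta^2 is at most B <= B^2. *)
Lemma normc_le_oneDsqr s eta : normc (s +i* eta) <= (1 + eta ^+ 2) * oneDsqr s.
Proof.
have B1 : 1 <= (1 + eta ^+ 2) * oneDsqr s.
  by rewrite mulr_ege1 ?lerDl ?sqr_ge0.
rewrite -[leRHS]ger0_norm ?(le_trans ler01)// -sqrtr_sqr /=; apply: ler_wsqrtr.
apply: (@le_trans _ _ ((1 + eta ^+ 2) * oneDsqr s)); last first.
  by rewrite expr2 ler_peMl// (le_trans ler01).
rewrite /oneDsqr mulrDl mul1r mulrDr mulr1.
have := mulr_ge0 (sqr_ge0 eta) (sqr_ge0 s); lra.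
Qed.

Definition kernel m x t eta s : Rcomplex R :=
  (s +i* eta) ^+ m * phase x t (s +i* eta).

Definition kernel_bound m x t eta : R :=
  expR (- eta * x + t * eta ^+ 3 + 3 * eta * t) *
  ((1 + eta ^+ 2) ^+ m * m.+1`!%:R / (3 * eta * t) ^+ m.+1).

(* With W = 1 + s^2 and a = 3 eta t, |z|^m <= ((1 + eta^2) W)^m and
   e^(- a s^2) = e^a e^(- a W) <= e^a (m + 1)! / (a W)^(m + 1). *)
Lemma normc_kernel_le m x t eta s : 0 < t -> 0 < eta ->
  normc (kernel m x t eta s) <= kernel_bound m x t eta / oneDsqr s.
Proof.
move=> t0 e0; rewrite normcM normcX normc_phase.
have W0 : 0 < oneDsqr s by rewrite (lt_le_trans ltr01).
have a0 : 0 < 3 * eta * t by rewrite !mulr_gt0.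
rewrite (_ : - eta * x + _ - _ = - eta * x + t * eta ^+ 3 + 3 * eta * t +
  - (3 * eta * t * oneDsqr s)); last by rewrite /oneDsqr; ring.
rewrite expRD.
apply: (@le_trans _ _ (((1 + eta ^+ 2) * oneDsqr s) ^+ m *
  (expR (- eta * x + t * eta ^+ 3 + 3 * eta * t) *
   (m.+1`!%:R / (3 * eta * t * oneDsqr s) ^+ m.+1)))).
  apply: ler_pM.
  - by rewrite exprn_ge0// sqrtr_ge0.
  - by rewrite mulr_ge0 ?expR_ge0.
  - by rewrite lerXn2r ?nnegrE ?sqrtr_ge0 ?mulr_ge0 ?normc_le_oneDsqr ?(ltW W0)// addr_ge0 ?sqr_ge0.
  - by rewrite ler_wpM2l ?expR_ge0// expRN_le_Vexpn// mulr_gt0.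
rewrite le_eqVlt; apply/orP; left; apply/eqP.
rewrite /kernel_bound; set E := expR _; set b := 1 + _; set a := 3 * _ * _.
rewrite !exprMn [oneDsqr s ^+ m.+1]exprS.
have Wm : oneDsqr s ^+ m != 0 by rewrite expf_neq0// gt_eqF.
have W1 : oneDsqr s != 0 by rewrite gt_eqF.
by field; rewrite W1 Wm !expf_neq0 ?gt_eqF.
Qed.

(** [kernel_bound] made uniform over |x| <= X, t1 <= t <= t2 and e1 <= eta <= e2: numerators are
    taken at the upper ends, the denominator at the lower ones. *)
Definition kernel_unif m (X t1 t2 e1 e2 : R) : R :=
  expR (e2 * X + t2 * e2 ^+ 3 + 3 * e2 * t2) *
  ((1 + e2 ^+ 2) ^+ m * m.+1`!%:R / (3 * e1 * t1) ^+ m.+1).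

Lemma normc_kernel_unif m x t eta s (X t1 t2 e1 e2 : R) : `|x| <= X ->
  0 < t1 -> t1 <= t <= t2 -> 0 < e1 -> e1 <= eta <= e2 ->
  normc (kernel m x t eta s) <= kernel_unif m X t1 t2 e1 e2 / oneDsqr s.
Proof.
move=> xX t10 /andP[t1t tt2] e10 /andP[e1e ee2].
have t0 := lt_le_trans t10 t1t; have e0 := lt_le_trans e10 e1e.
apply: le_trans (normc_kernel_le m x s t0 e0) _.
have W0 : 0 < oneDsqr s by rewrite (lt_le_trans ltr01).
rewrite ler_wpM2r ?invr_ge0 ?(ltW W0)//.
rewrite /kernel_bound /kernel_unif.
have a1 : 0 < 3 * e1 * t1 by rewrite !mulr_gt0.
have a0 : 0 < 3 * eta * t by rewrite !mulr_gt0.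
have b0 (e : R) : 0 <= 1 + e ^+ 2 by rewrite addr_ge0 ?sqr_ge0.
apply: ler_pM.
- exact: expR_ge0.
- by rewrite !mulr_ge0 ?invr_ge0 ?exprn_ge0 ?(ltW a0).
- rewrite ler_expR !lerD//.
  + rewrite mulNr -mulrN; apply: (@le_trans _ _ (eta * X)).
      by rewrite ler_wpM2l ?(ltW e0)// (le_trans _ xX)// -normrN ler_norm.
    by rewrite ler_wpM2r// (le_trans _ xX).
  + by rewrite ler_pM ?(ltW t0) ?exprn_ge0 ?(ltW e0)// lerXn2r ?nnegrE ?(le_trans (ltW e0)) ?(ltW e0).
  + by rewrite ler_pM ?(ltW t0) ?mulr_ge0 ?(ltW e0)// ler_wpM2l.
- apply: ler_pM.
  + by rewrite mulr_ge0 ?exprn_ge0.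
  + by rewrite invr_ge0 exprn_ge0// ltW.
  + rewrite ler_wpM2r// lerXn2r ?nnegrE// lerD2l lerXn2r ?nnegrE//.
      exact: ltW.
    exact: le_trans (ltW e0) _.
  + rewrite lef_pV2 ?posrE ?exprn_gt0// lerXn2r ?nnegrE ?(ltW a0) ?(ltW a1)//.
    by rewrite ler_pM ?mulr_ge0 ?(ltW e10) ?(ltW t10)// ler_wpM2l.
Qed.

End phase_kernel.

Section kernel_derivatives.
Context {R : realType}.
Implicit Types (x t eta s : R) (m : nat).

Lemma is_derive_kernel_t m x t eta s :
  is_derive t 1 (fun t => kernel m x t eta s) ('i%C * kernel m.+3 x t eta s).
Proof.
set z := s +i* eta.
have h : is_derive t 1 (fun t => 'i%C * z * x%:C + 'i%C * z ^+ 3 * t%:C : Rcomplex R)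
    (0 + 'i%C * z ^+ 3 * 1%:C).
  by apply: is_derive_addc; apply: is_derive_mulcl; exact: is_derive_real_complex.
apply: (is_derive_eq (is_derive_mulcl (z ^+ m : Rcomplex R) (is_derive_cexp h))).
have e (a p : R[i]) : z ^+ m * ((0 + a * z ^+ 3 * 1) * p) = a * (z ^+ m.+3 * p).
  by rewrite -[m.+3]addn3 exprD; ring.
exact: e.
Qed.

Lemma is_derive_kernel_x m x t eta s :
  is_derive x 1 (fun x => kernel m x t eta s) ('i%C * kernel m.+1 x t eta s).
Proof.
set z := s +i* eta.
have h : is_derive x 1 (fun x => 'i%C * z * x%:C + 'i%C * z ^+ 3 * t%:C : Rcomplex R)
    ('i%C * z * 1%:C + 0).
  by apply: is_derive_addc; apply: is_derive_mulcl; exact: is_derive_real_complex.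
apply: (is_derive_eq (is_derive_mulcl (z ^+ m : Rcomplex R) (is_derive_cexp h))).
have e (a p : R[i]) : z ^+ m * ((a * z * 1 + 0) * p) = a * (z ^+ m.+1 * p).
  by rewrite exprS; ring.
exact: e.
Qed.

(** The complex derivative d/dz of z^m e^(izx + i z^3 t) at z = s + i eta. For [m = 0] the truncated
    [m.-1] is harmless, its coefficient being 0. *)
Definition kernel_derivative m x t eta s : Rcomplex R :=
  m%:R * kernel m.-1 x t eta s + ('i%C * x%:C * kernel m x t eta s +
  3 * 'i%C * t%:C * kernel m.+2 x t eta s).

(** Chain rule along a curve in the complex plane. With [dz] equal to 1 and to i it yields the
    derivatives in [s] and in [eta], hence the factor i between them. *)
Lemma is_derive_kernel_curve m x t (z : R -> Rcomplex R) (y : R) (dz : Rcomplex R) :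
  is_derive y 1 z dz ->
  is_derive y 1 (fun y => z y ^+ m * phase x t (z y) : Rcomplex R)
    (dz * kernel_derivative m x t (complex.Im (z y)) (complex.Re (z y))).
Proof.
move=> zdz.
have h := is_derive_addc
  (is_derive_mulcl 'i%C (is_derive_mulc zdz
    (is_derive_cst (x%:C : Rcomplex R) y 1)))
  (is_derive_mulcl 'i%C (is_derive_mulc (is_derive_expc 3 zdz)
    (is_derive_cst (t%:C : Rcomplex R) y 1))).
have H := is_derive_mulc (is_derive_expc m zdz) (is_derive_cexp h).
rewrite (_ : (fun y => _) = (fun y => z y ^+ m *
    cexp ('i%C * (z y * x%:C) + 'i%C * (z y ^+ 3 * t%:C)) : Rcomplex R)); last first.
  by apply/funext => w; rewrite /phase !mulrA.
apply: (is_derive_eq H).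
rewrite /kernel_derivative /kernel.
rewrite [complex.Re (z y) +i* _](_ : _ = z y); last by case: (z y).
rewrite (_ : cexp _ = phase x t (z y)); last by rewrite /phase !mulrA.
have e (a d w p X T : R[i]) : (m%:R * w ^+ m.-1 * d) * p + w ^+ m *
    ((a * (d * X + w * 0) + a * ((3%:R * w ^+ 2 * d) * T + w ^+ 3 * 0)) * p) =
    d * (m%:R * (w ^+ m.-1 * p) + (a * X * (w ^+ m * p) +
    3 * a * T * (w ^+ m.+2 * p))).
  by rewrite -[m.+2]addn2 exprD; ring.
exact: e.
Qed.
End kernel_derivatives.

(** * The moments J_m: derivatives and independence of the line *)

Section kernel_integral.
Context {R : realType}.
Implicit Types (x t eta s : R) (m : nat).

Lemma is_derive_continuous (W : normedModType R) (f : R -> W) :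
  (forall x : R, exists d, is_derive x 1 f d) -> continuous f.
Proof.
move=> df x; apply/differentiable_continuous/derivable1_diffP.
by have [d [+ _]] := df x.
Qed.

Lemma is_derive_kernel_s m x t eta s :
  is_derive s 1 (kernel m x t eta) (kernel_derivative m x t eta s).
Proof.
have := is_derive_kernel_curve m x t (is_derive_line_Re eta s).
by rewrite mul1r.
Qed.

Lemma is_derive_kernel_eta m x t eta s :
  is_derive eta 1 (fun eta => kernel m x t eta s)
    ('i%C * kernel_derivative m x t eta s).
Proof. by have := is_derive_kernel_curve m x t (is_derive_line_Im s eta). Qed.

Lemma continuous_kernel m x t eta : continuous (kernel m x t eta).
Proof.
apply: is_derive_continuous => s; exists (kernel_derivative m x t eta s).
exact: is_derive_kernel_s.
Qed.

Lemma continuous_kernel_derivative m x t eta :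
  continuous (kernel_derivative m x t eta).
Proof.
apply: is_derive_continuous => s; eexists.
have K k (c : Rcomplex R) := is_derive_mulcl c (is_derive_kernel_s k x t eta s).
exact: (is_derive_addc (K _ _) (is_derive_addc (K _ _) (K _ _))).
Qed.

Lemma normc_kernel_derivative m x t eta s (X t1 t2 e1 e2 : R) : `|x| <= X ->
  0 < t1 -> t1 <= t <= t2 -> 0 < e1 -> e1 <= eta <= e2 ->
  normc (kernel_derivative m x t eta s) <=
  (m%:R * kernel_unif m.-1 X t1 t2 e1 e2 + (X * kernel_unif m X t1 t2 e1 e2 +
   3 * t2 * kernel_unif m.+2 X t1 t2 e1 e2)) / oneDsqr s.
Proof.
move=> xX t10 tt e10 ee.
have t0 : 0 <= t by rewrite (le_trans (ltW t10))//; case/andP: tt.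
have nR (a : R) : 0 <= a -> normc a%:C = a.
  by move=> a0; rewrite /= expr0n addr0 sqrtr_sqr ger0_norm.
have ni : normc ('i%C : R[i]) = 1 by rewrite /= expr0n add0r expr1n sqrtr1.
have nn (k : nat) : normc (k%:R : R[i]) = k%:R.
  by rewrite -(rmorph_nat (real_complex R)) nR.
have nx : normc x%:C <= X by rewrite /= expr0n addr0 sqrtr_sqr.
have K k := normc_kernel_unif k s xX t10 tt e10 ee.
move: (K m.-1) (K m) (K m.+2) => {K}.
set A := kernel_unif m.-1 _ _ _ _ _; set B := kernel_unif m _ _ _ _ _.
set C := kernel_unif m.+2 _ _ _ _ _.
move: A B C => A B C.
rewrite /kernel_derivative.
move: (kernel m.-1 x t eta s) (kernel m x t eta s) (kernel m.+2 x t eta s).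
move=> k0 k1 k2 KA KB KC.
rewrite [leRHS](_ : _ = m%:R * (A / oneDsqr s) +
  (X * (B / oneDsqr s) + 3 * (t2 * (C / oneDsqr s)))); last by ring.
apply: le_trans (le_normcD _ _) _; apply: lerD.
  rewrite normcM nn; exact: ler_wpM2l.
apply: le_trans (le_normcD _ _) _; apply: lerD.
  rewrite -mulrA !normcM ni mul1r; apply: ler_pM.
  - exact: normc_ge0.
  - exact: normc_ge0.
  - exact: nx.
  - exact: KB.
have e3 (z : R[i]) : normc (3 * 'i%C * t%:C * z) = 3 * (t * normc z).
  by rewrite !normcM ni mulr1 nR// nn -mulrA.
rewrite [leLHS](e3 k2).
apply: ler_wpM2l => //; apply: ler_pM => //.
- exact: normc_ge0.
- by case/andP: tt.
Qed.

Lemma integrable_kernel m x t eta : 0 < t -> 0 < eta ->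
  Rcomplex_integrable (kernel m x t eta).
Proof.
move=> t0 e0; apply: Rcomplex_integrable_le (@continuous_kernel _ _ _ _) _ => s.
exact: normc_kernel_le.
Qed.

Definition kernel_integral m x t eta := Rcomplex_integral (kernel m x t eta).

Let itv_half (a : R) : 0 < a -> a / 2 < a < 2 * a.
Proof. by move=> a0; apply/andP; split; lra. Qed.

Let half_gt0 (a b : R) : 0 < a -> a / 2 < b -> 0 < b.
Proof. by move=> a0; apply: lt_trans; rewrite divr_gt0. Qed.

Lemma normc_mulI (z : R[i]) : normc ('i%C * z) = normc z.
Proof. by rewrite normcM /= expr0n add0r expr1n sqrtr1 mul1r. Qed.

Lemma is_derive_kernel_integral_t m x t eta : 0 < t -> 0 < eta ->
  is_derive t 1 (fun t => kernel_integral m x t eta)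
    ('i%C * kernel_integral m.+3 x t eta).
Proof.
move=> t0 e0; rewrite /kernel_integral.
rewrite -Rcomplex_integralZl; last exact: integrable_kernel.
(* The interval ]t / 2, 2 t[ stays away from 0, where the bound on the kernel blows up. *)
apply: (@is_derive_Rcomplex_integral R (fun t => kernel m x t eta)
  (fun t s => 'i%C * kernel m.+3 x t eta s) (t / 2) (2 * t) _
  (kernel_unif m.+3 `|x| (t / 2) (2 * t) eta eta)).
- exact: itv_half.
- by move=> y /andP[/(half_gt0 t0) y0 _]; exact: integrable_kernel.
- by move=> y s _; exact: is_derive_kernel_t.
- move=> y s /andP[y1 y2]; rewrite normc_mulI.
  by apply: normc_kernel_unif; rewrite ?divr_gt0 ?lexx ?(ltW y1) ?(ltW y2).
Qed.

Lemma is_derive_kernel_integral_x m x t eta : 0 < t -> 0 < eta ->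
  is_derive x 1 (fun x => kernel_integral m x t eta)
    ('i%C * kernel_integral m.+1 x t eta).
Proof.
move=> t0 e0; rewrite /kernel_integral.
rewrite -Rcomplex_integralZl; last exact: integrable_kernel.
apply: (@is_derive_Rcomplex_integral R (fun x => kernel m x t eta)
  (fun x s => 'i%C * kernel m.+1 x t eta s) (x - 1) (x + 1) _
  (kernel_unif m.+1 (`|x| + 1) t t eta eta)).
- by apply/andP; split; lra.
- by move=> y _; exact: integrable_kernel.
- by move=> y s _; exact: is_derive_kernel_x.
- move=> y s yx; rewrite normc_mulI.
  apply: normc_kernel_unif; rewrite ?lexx//.
  have : `|y - x| <= 1 by rewrite ler_norml; apply/andP; split; lra.
  have := ler_normD (y - x) x; rewrite subrK; lra.
Qed.

(** A total s-derivative with vanishing boundary terms. Term by term this is the recurrence m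
    J_(m-1) + i x J_m + 3 i t J_(m+2) = 0. *)
Lemma kernel_integral_derivative m x t eta : 0 < t -> 0 < eta ->
  Rcomplex_integral (kernel_derivative m x t eta) = 0.
Proof.
move=> t0 e0.
pose M := kernel_unif m `|x| t t eta eta.
pose M' := m%:R * kernel_unif m.-1 `|x| t t eta eta +
 (`|x| * M + 3 * t * kernel_unif m.+2 `|x| t t eta eta).
(* A single constant has to bound both the kernel and its derivative. *)
apply: (@Rcomplex_integral_derive_eq0 _ (kernel m x t eta) _ (Num.max M M')).
- by move=> s; exact: is_derive_kernel_s.
- exact: continuous_kernel_derivative.
- move=> s; apply: (@le_trans _ _ (M / oneDsqr s)).
    by apply: normc_kernel_unif; rewrite ?lexx.
  by rewrite ler_wpM2r ?le_max ?lexx// invr_ge0 (le_trans ler01).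
- move=> s; apply: (@le_trans _ _ (M' / oneDsqr s)).
    by apply: normc_kernel_derivative; rewrite ?lexx.
  by rewrite ler_wpM2r ?le_max ?lexx ?orbT// invr_ge0 (le_trans ler01).
Qed.

Lemma integrable_kernel_derivative m x t eta : 0 < t -> 0 < eta ->
  Rcomplex_integrable (kernel_derivative m x t eta).
Proof.
move=> t0 e0; apply: Rcomplex_integrable_le (@continuous_kernel_derivative _ _ _ _) _ => s.
by apply: (@normc_kernel_derivative _ _ _ _ _ `|x| t t eta eta); rewrite ?lexx.
Qed.

(** Cauchy's theorem for a shift of the line, in infinitesimal form. *)
Lemma is_derive_kernel_integral_eta m x t eta : 0 < t -> 0 < eta ->
  is_derive eta 1 (fun eta => kernel_integral m x t eta) 0.
Proof.
move=> t0 e0.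
rewrite (_ : 0 = Rcomplex_integral (fun s => 'i%C * kernel_derivative m x t eta s)); last first.
  rewrite Rcomplex_integralZl; last exact: integrable_kernel_derivative.
  by rewrite kernel_integral_derivative// mulr0.
apply: (@is_derive_Rcomplex_integral R (kernel m x t)
  (fun e s => 'i%C * kernel_derivative m x t e s) (eta / 2) (2 * eta) _
  (m%:R * kernel_unif m.-1 `|x| t t (eta / 2) (2 * eta) +
   (`|x| * kernel_unif m `|x| t t (eta / 2) (2 * eta) +
   3 * t * kernel_unif m.+2 `|x| t t (eta / 2) (2 * eta)))).
- exact: itv_half.
- by move=> y /andP[/(half_gt0 e0) y0 _]; exact: integrable_kernel.
- by move=> y s _; exact: is_derive_kernel_eta.
- move=> y s /andP[y1 y2]; rewrite normc_mulI.
  by apply: normc_kernel_derivative; rewrite ?divr_gt0 ?lexx ?(ltW y1) ?(ltW y2).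
Qed.

(** Substituting eta = e^y turns the half-line eta > 0 into all of [R], where a function with zero
    derivative is constant. *)
Lemma kernel_integral_indep m x t (e1 e2 : R) : 0 < t -> 0 < e1 -> 0 < e2 ->
  kernel_integral m x t e1 = kernel_integral m x t e2.
Proof.
move=> t0 e10 e20.
have h (y : R) : is_derive (expR y) 1 (kernel_integral m x t) 0.
  by apply: is_derive_kernel_integral_eta; rewrite ?expR_gt0.
rewrite -(lnK (e10 : e1 \is Num.pos)) -(lnK (e20 : e2 \is Num.pos)).
set z1 := kernel_integral _ _ _ _; set z2 := kernel_integral _ _ _ _.
have hr : complex.Re z1 = complex.Re z2.
  apply: (@is_derive_0_is_cst _
    (fun y => complex.Re (kernel_integral m x t (expR y)))) => y.
  have /is_derive_RcomplexP[hr _] := h y.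
  apply: (is_derive_eq (is_derive1_comp hr (is_derive_expR y))).
  by rewrite mul0r.
have hi : complex.Im z1 = complex.Im z2.
  apply: (@is_derive_0_is_cst _
    (fun y => complex.Im (kernel_integral m x t (expR y)))) => y.
  have /is_derive_RcomplexP[_ hi] := h y.
  apply: (is_derive_eq (is_derive1_comp hi (is_derive_expR y))).
  by rewrite mul0r.
by move: z1 z2 hr hi => [? ?] [? ?] /= -> ->.
Qed.

End kernel_integral.

(** * Boundary and initial values, and nonvanishing *)

Section kernel_integral_limits.
Context {R : realType}.
Implicit Types (x t eta s : R) (m : nat).
Let mu := @lebesgue_measure R.

(** For m = 0 and x = 0 the recurrence reduces to 3 i t J_2 = 0. Then J_(3k+2)(0, t) vanishes for
    all t > 0, and so does its t-derivative i J_(3k+5)(0, t). *)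
Lemma kernel_integral_at0 (k : nat) t eta : 0 < t -> 0 < eta ->
  kernel_integral (3 * k + 2) 0 t eta = 0.
Proof.
move=> + e0; elim: k t => [|k IH] t t0.
  have : Rcomplex_integral (fun s => (3 * 'i%C * t%:C) * kernel 2 0 t eta s) = 0.
    rewrite -[RHS](@kernel_integral_derivative _ 0 0 t eta)//.
    congr Rcomplex_integral; apply/funext => s.
    by rewrite /kernel_derivative mul0r add0r mulr0 mul0r add0r.
  rewrite Rcomplex_integralZl; last exact: integrable_kernel.
  move/eqP; rewrite mulf_eq0 => /orP[|/eqP//].
  rewrite !mulf_eq0 pnatr_eq0/= !eq_complex /= oner_eq0 andbF/=.
  by rewrite gt_eqF.
have h := @is_derive_kernel_integral_t _ (3 * k + 2) 0 t eta t0 e0.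
have h0 : is_derive t 1 (fun t => kernel_integral (3 * k + 2) 0 t eta) (0 : Rcomplex R).
  apply: (@near_eq_is_derive _ _ _ (cst 0)) => //.
  near=> y; rewrite /= IH//.
  by near: y; exact: lt_nbhsr.
have e : 'i%C * kernel_integral (3 * k + 2).+3 0 t eta = 0.
  by have [_ <-] := h; have [_ <-] := h0.
rewrite (_ : (3 * k.+1 + 2 = (3 * k + 2).+3)%N); last by lia.
move/eqP: e; rewrite mulf_eq0 => /orP[|/eqP//].
by rewrite eq_complex /= oner_eq0 andbF.
Unshelve. all: by end_near. Qed.

(** For t > 0 the moment is differentiable in x on the whole real line, hence continuous at 0. *)
Lemma cvg_kernel_integral_x m t eta : 0 < t -> 0 < eta ->
  kernel_integral m x t eta @[x --> 0^'+] --> kernel_integral m 0 t eta.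
Proof.
move=> t0 e0; apply: cvg_at_right_filter.
apply: (is_derive_continuous (f := fun x => kernel_integral m x t eta)) => x.
by eexists; exact: is_derive_kernel_integral_x.
Qed.

(** The factor 2 comes from bounding the real and imaginary parts separately. *)
Lemma normc_Rcomplex_integral_le (F : R -> Rcomplex R) (M : R) : continuous F ->
  (forall s, normc (F s) <= M / oneDsqr s) ->
  normc (Rcomplex_integral F) <= 2 * (M * \int[mu]_s (oneDsqr s)^-1).
Proof.
move=> cF FM; have [ir ii] := Rcomplex_integrable_le cF FM.
apply: le_trans (normc_le_abs_ReIm _) _.
have iM : mu.-integrable setT (EFin \o (fun s => M / oneDsqr s)).
  rewrite /comp; under eq_fun do rewrite EFinM.
  by apply: integrableZl => //; exact: integrable_oneDsqrV.
have le (f : R -> R) : mu.-integrable setT (EFin \o f) ->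
    (forall s, `|f s| <= normc (F s)) ->
    `|\int[mu]_s f s| <= M * \int[mu]_s (oneDsqr s)^-1.
  move=> if_ fF; rewrite -RintegralZl//; last exact: integrable_oneDsqrV.
  apply: le_trans (le_normr_Rintegral measurableT if_) _.
  apply: le_Rintegral => //.
    by have := integrable_abse if_; apply: eq_integrable.
  by move=> s _; exact: le_trans (fF s) (FM s).
rewrite mulr_natl mulr2n; apply: lerD; apply: le => // s.
  exact: abs_Re_le_normc.
exact: abs_Im_le_normc.
Qed.

(* With eta = d / sqrt t and d^2 = x / 2, the exponent - eta x + t eta^3 is
   - d x / (2 sqrt t), which beats the powers of 1 / sqrt t in kernel_bound. *)
Lemma kernel_bound_small_t m x : 0 < x ->
  exists D : R, forall t, 0 < t -> t <= 1 ->
    kernel_bound m x t (Num.sqrt (x / 2) / Num.sqrt t) <= D * Num.sqrt t.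
Proof.
move=> x0; set d := Num.sqrt (x / 2).
have d0 : 0 < d by rewrite sqrtr_gt0 divr_gt0.
have d2 : d ^+ 2 = x / 2 by rewrite sqr_sqrtr// divr_ge0// ltW.
pose c := d * x / 2; have c0 : 0 < c by rewrite /c !mulr_gt0.
(* Put q = sqrt t. The factor (1 + eta^2)^m costs q^(- 2m) and the denominator (3 eta t)^(m+1) costs
   q^(- m - 1), so the power 3m + 2 in the bound for exp (- c / q) leaves exactly one factor q. *)
exists (expR (3 * d) * ((3 * m).+2`!%:R / c ^+ (3 * m).+2) *
  ((1 + d ^+ 2) ^+ m * m.+1`!%:R / (3 * d) ^+ m.+1)) => t t0 t1.
pose q := Num.sqrt t; have q0 : 0 < q by rewrite sqrtr_gt0.
have q1 : q <= 1 by rewrite -sqrtr1 ler_wsqrtr.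
have tq : t = q ^+ 2 by rewrite sqr_sqrtr// ltW.
have qn0 : q != 0 by rewrite gt_eqF.
rewrite -/q /kernel_bound {}tq.
rewrite (_ : - (d / q) * x + _ + _ = 3 * d * q + - (c / q)); last first.
  rewrite /c (_ : x = 2 * d ^+ 2); last by rewrite d2; field.
  by field.
rewrite (_ : 3 * (d / q) * q ^+ 2 = 3 * d * q); last by field.
rewrite expRD.
have cq0 : 0 < c / q by rewrite divr_gt0.
apply: (@le_trans _ _ (expR (3 * d) * ((3 * m).+2`!%:R / (c / q) ^+ (3 * m).+2) *
  (((1 + d ^+ 2) / q ^+ 2) ^+ m * m.+1`!%:R / (3 * d * q) ^+ m.+1))).
  apply: ler_pM.
  - by rewrite mulr_ge0 ?expR_ge0.
  - by rewrite !mulr_ge0 ?invr_ge0 ?exprn_ge0 ?addr_ge0 ?sqr_ge0// !mulr_ge0// ltW.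
  - apply: ler_pM; rewrite ?expR_ge0//.
      by rewrite ler_expR ler_piMr// mulr_ge0// ltW.
    exact: expRN_le_Vexpn.
  - rewrite ler_wpM2r ?invr_ge0 ?exprn_ge0 ?mulr_ge0 ?(ltW d0) ?(ltW q0)//.
    rewrite ler_wpM2r// lerXn2r ?nnegrE ?divr_ge0 ?addr_ge0 ?sqr_ge0//.
    rewrite mulrDl expr_div_n lerD2r mul1r invf_ge1 ?exprn_gt0//.
    by rewrite exprn_ile1// ltW.
rewrite le_eqVlt; apply/orP; left; apply/eqP.
rewrite (expr_div_n c q) (expr_div_n _ (q ^+ 2) m) [(3 * d * q) ^+ _]exprMn.
have -> : (q ^+ (3 * m).+2) = q * q ^+ m.+1 * (q ^+ 2) ^+ m.
  by rewrite -exprM -exprS -exprD; congr (_ ^+ _); lia.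
have qm : q ^+ m.+1 != 0 by rewrite expf_neq0.
have q2m : (q ^+ 2) ^+ m != 0 by rewrite !expf_neq0.
move: (q ^+ m.+1) ((q ^+ 2) ^+ m) qm q2m => Q1 Q2 Q10 Q20.
set E := expR _; set A := (1 + _) ^+ m; set F1 := _`!%:R; set F2 := _`!%:R.
have cm : c ^+ (3 * m).+2 != 0 by rewrite expf_neq0// gt_eqF.
have dm : (3 * d) ^+ m.+1 != 0 by rewrite expf_neq0// mulf_neq0// gt_eqF.
move: (c ^+ _) ((3 * d) ^+ m.+1) cm dm => C D1 C0 D10.
by field; rewrite Q10 Q20 C0 D10 qn0.
Qed.

(** Independence of the line allows [eta] to be replaced by a height that grows as t tends to 0;
    there the integral is O(sqrt t). *)
Lemma cvg_kernel_integral_t m x eta : 0 < x -> 0 < eta ->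
  kernel_integral m x t eta @[t --> 0^'+] --> (0 : Rcomplex R).
Proof.
move=> x0 e0; have [D HD] := kernel_bound_small_t m x0.
(* The absolute values dispense with the signs of the two factors, and the summand 1 makes [K]
   positive. *)
pose K := 2 * (`|D| * `|\int[mu]_s (oneDsqr s)^-1|) + 1.
have K0 : 0 < K by rewrite ltr_wpDl// mulr_ge0// mulr_ge0.
apply/cvgrPdist_lt => e ee.
have sq : Num.sqrt t @[t --> 0^'+] --> (0 : R).
  rewrite -[X in _ --> X]sqrtr0; apply: cvg_at_right_filter.
  exact: sqrt_continuous.
near=> t.
have t0 : 0 < t by near: t; exact: nbhs_right_gt.
have t1 : t <= 1 by near: t; exact: nbhs_right_le.
have d0 : 0 < Num.sqrt (x / 2) / Num.sqrt t.
  by rewrite divr_gt0 ?sqrtr_gt0 ?divr_gt0.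
rewrite sub0r normrN (kernel_integral_indep m x t0 e0 d0).
apply: le_lt_trans (normc_Rcomplex_integral_le (@continuous_kernel _ _ _ _ _)
  (fun s => normc_kernel_le m x s t0 d0)) _.
have h : Num.sqrt t < e / K.
  by near: t; apply: cvgr_lt sq _ _; rewrite divr_gt0.
rewrite ltr_pdivlMr// mulrC in h; apply: le_lt_trans h.
rewrite /K [leRHS]mulrDl mul1r -[leLHS]addr0; apply: lerD; last exact: sqrtr_ge0.
rewrite -[leRHS]mulrA; apply: ler_wpM2l => //.
rewrite [leRHS]mulrAC; apply: le_trans (ler_norm _) _.
rewrite normrM; apply: ler_wpM2r => //.
rewrite ger0_norm; last first.
  rewrite /kernel_bound mulr_ge0 ?expR_ge0// !mulr_ge0 ?invr_ge0 ?exprn_ge0 ?addr_ge0 ?sqr_ge0//.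
  by rewrite !mulr_ge0// ltW.
apply: le_trans (HD t t0 t1) _.
by apply: ler_wpM2r; [exact: sqrtr_ge0|exact: ler_norm].
Unshelve. all: by end_near. Qed.

End kernel_integral_limits.

(** * Nonvanishing of J_2 on the line through the saddle point *)

Section kernel_integral_nonzero.
Context {R : realType}.
Implicit Types (x t eta s : R).
Let mu := @lebesgue_measure R.

Lemma normr_sin_le (x : R) : `|sin x| <= `|x|.
Proof.
wlog x0 : x / 0 <= x.
  move=> h; have [|/ltW x0] := leP 0 x; first exact: h.
  by have := h (- x); rewrite oppr_ge0 sinN !normrN; exact.
rewrite le_eqVlt in x0; case/predU1P : x0 => [<-|x0]; first by rewrite sin0.
have cs : {within `[0, x], continuous (@sin R)}.
  by apply: continuous_subspaceT; exact: continuous_sin.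
have [c _] := MVT x0 (fun y _ => is_derive_sin y) cs.
by rewrite sin0 !subr0 => ->; rewrite normrM ler_piMl// cos_max.
Qed.

(** From cos x = 1 - 2 sin^2 (x / 2) and |sin (x / 2)| <= |x / 2|. *)
Lemma cos_ge1Bsqr (x : R) : 1 - x ^+ 2 / 2 <= cos x.
Proof.
have {2}-> : x = (x / 2) *+ 2 by rewrite -mulr_natr; field.
rewrite cos_mulr2n cos2sin2.
have : sin (x / 2) ^+ 2 <= (x / 2) ^+ 2.
  rewrite -real_normK ?num_real// -[leRHS]real_normK ?num_real//.
  by rewrite lerXn2r ?nnegrE ?normr_sin_le.
rewrite -mulr_natr expr_div_n; lra.
Qed.

(* For 3 eta t = 1 and x = eta the line Im z = eta passes through the saddle
   point z = i eta of the phase, which there is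
   exp (- 2 eta^2 / 3 - s^2 + i s^3 / (3 eta)). *)
Lemma Re_kernel_saddle_le eta s : 0 < eta ->
  complex.Re (kernel 2 eta (3 * eta)^-1 eta s) <=
  expR (- (2 / 3 * eta ^+ 2)) *
    (24 * expR 1 * (oneDsqr s)^-1 - eta ^+ 2 * gauss_fun s).
Proof.
move=> e0; have en0 : eta != 0 by rewrite gt_eqF.
have W0 : 0 < oneDsqr s by rewrite (lt_le_trans ltr01).
rewrite /kernel /phase cexpE.
rewrite Re_phase_exponent.
have -> : complex.Im ('i%C * (s +i* eta) * eta%:C +
    'i%C * (s +i* eta) ^+ 3 * ((3 * eta)^-1)%:C) = s ^+ 3 / (3 * eta).
  by rewrite !exprS expr0 /=; field.
rewrite (_ : - eta * eta + _ - _ = - (2 / 3 * eta ^+ 2) + - s ^+ 2); last by field.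
rewrite expRD -/(gauss_fun s); set th := s ^+ 3 / (3 * eta).
set E := expR (- (2 / 3 * _)); set G := gauss_fun s.
have E0 : 0 < E by exact: expR_gt0.
have G0 : 0 <= G by exact: gauss_fun_ge0.
have -> : complex.Re ((s +i* eta) ^+ 2 * ((E * G * cos th) +i* (E * G * sin th))) =
    E * (G * ((s ^+ 2 - eta ^+ 2) * cos th - 2 * s * eta * sin th)).
  by rewrite !exprS expr0 /=; ring.
rewrite ler_pM2l//.
(* With W = 1 + s^2, exp (- s^2) = e exp (- W) <= e 4! / W^4; this is where the constant 24 e comes
   from. *)
have GW : G * oneDsqr s ^+ 3 <= 24 * expR 1 * (oneDsqr s)^-1.
  rewrite /G /gauss_fun (_ : - s ^+ 2 = 1 + - oneDsqr s); last by rewrite /oneDsqr; ring.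
  rewrite expRD [24 * _]mulrC -!mulrA; apply: ler_wpM2l; first exact: expR_ge0.
  rewrite [leRHS](_ : _ = 4`!%:R / oneDsqr s ^+ 4 * oneDsqr s ^+ 3); last first.
    by rewrite (_ : 4`! = 24)%N//; field; rewrite gt_eqF.
  by apply: ler_wpM2r; [rewrite exprn_ge0// ltW|exact: expRN_le_Vexpn].
apply: (@le_trans _ _ (G * oneDsqr s ^+ 3 - eta ^+ 2 * G)); last by rewrite lerD2r.
rewrite [eta ^+ 2 * G]mulrC -mulrBr; apply: ler_wpM2l => //.
(* It remains to bound (s^2 - eta^2) cos th - 2 s eta sin th by W^3 - eta^2. As th = s^3 / (3 eta),
   replacing eta^2 cos th by eta^2 costs s^6 / 18 and the sine term costs 2 s^4 / 3, both free of
   eta. *)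
have c1 : cos th <= 1 := cos_le1 th.
have c2 := cos_ge1Bsqr th.
have h1 : s ^+ 2 * cos th <= s ^+ 2 by rewrite ler_piMr// sqr_ge0.
have h2 : eta ^+ 2 - s ^+ 6 / 18 <= eta ^+ 2 * cos th.
  apply: le_trans (ler_wpM2l (sqr_ge0 eta) c2).
  by rewrite le_eqVlt; apply/orP; left; apply/eqP; rewrite /th; field.
have h3 : - (2 * s * eta * sin th) <= 2 / 3 * s ^+ 4.
  apply: le_trans (ler_norm _) _; rewrite normrN normrM.
  apply: le_trans (ler_wpM2l (normr_ge0 _) (normr_sin_le th)) _.
  rewrite -normrM ger0_norm.
    by rewrite le_eqVlt; apply/orP; left; apply/eqP; rewrite /th; field.
  rewrite (_ : _ * th = 2 / 3 * (s ^+ 2) ^+ 2); last by rewrite /th; field.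
  by rewrite mulr_ge0// sqr_ge0.
have p2 := sqr_ge0 s.
have p4 : 0 <= s ^+ 4 by rewrite (_ : s ^+ 4 = (s ^+ 2) ^+ 2) ?sqr_ge0//; ring.
have p6 : 0 <= s ^+ 6 by rewrite (_ : s ^+ 6 = (s ^+ 3) ^+ 2) ?sqr_ge0//; ring.
rewrite (_ : oneDsqr s ^+ 3 = 1 + 3 * s ^+ 2 + 3 * s ^+ 4 + s ^+ 6); last first.
  by rewrite /oneDsqr; ring.
rewrite [X in X - _]mulrBl; lra.
Qed.

(** Integrating the saddle bound gives Re J_2 <= exp (- 2 eta^2 / 3) (A - eta^2 P), with P the Gauss
    integral; this is negative for large eta. *)
Lemma kernel_integral_saddle_neq0 : exists eta : R, 0 < eta /\
  kernel_integral 2 eta (3 * eta)^-1 eta <> 0.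
Proof.
pose K := \int[mu]_s (oneDsqr s)^-1; pose A := 24 * expR 1 * K.
pose P := \int[mu]_s gauss_fun s.
have P0 : 0 < P by rewrite /P /Rintegral integralT_gauss /= sqrtr_gt0 pi_gt0.
have A0 : 0 <= A.
  rewrite /A !mulr_ge0 ?expR_ge0//; apply: Rintegral_ge0 => s _.
  by rewrite invr_ge0 (le_trans ler01).
(* The choice ensures eta >= 1 and eta P > A, hence eta^2 P > A. *)
pose eta := A / P + 1; have e0 : 0 < eta by rewrite ltr_wpDl// divr_ge0// ltW.
exists eta; split => // /(congr1 (@complex.Re R)) /=.
apply/eqP; rewrite lt_eqF//.
have t0 : 0 < (3 * eta)^-1 by rewrite invr_gt0 mulr_gt0.
have [ik _] := integrable_kernel 2 eta t0 e0.
have iK := integrable_oneDsqrV (R := R).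
have iG := integrableT_gauss (R := R).
have iZ (k : R) (f : R -> R) : mu.-integrable setT (EFin \o f) ->
    mu.-integrable setT (EFin \o (fun s => k * f s)).
  move=> h; rewrite /comp; under eq_fun do rewrite EFinM.
  exact: integrableZl.
have iB : mu.-integrable setT (EFin \o (fun s =>
    24 * expR 1 * (oneDsqr s)^-1 - eta ^+ 2 * gauss_fun s)).
  rewrite /comp; under eq_fun do rewrite EFinB.
  by apply: integrableB => //; exact: iZ.
apply: le_lt_trans (le_Rintegral measurableT ik (iZ _ _ iB)
  (fun s _ => Re_kernel_saddle_le s e0)) _.
rewrite RintegralZl// pmulr_rlt0 ?expR_gt0//.
rewrite RintegralB//; [|exact: iZ..].
rewrite !RintegralZl// -/K -/P -/A subr_lt0.
have : A < eta * P by rewrite /eta mulrDl mul1r divfK ?gt_eqF// ltrDl.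
move/lt_le_trans; apply; rewrite expr2 -mulrA ler_peMl// ?mulr_ge0 ?(ltW e0) ?(ltW P0)//.
by rewrite /eta lerDr divr_ge0// ltW.
Qed.

End kernel_integral_nonzero.

(** * The function v and its t-derivatives as multiples of moments *)

Section the_solution.
Context {R : realType} (eps : R) (eps_gt0 : 0 < eps).
Implicit Types (x t s : R) (k : nat).

(** The integrand of [v], a kernel of order - 1; its pole 0 lies off the line. *)
Definition pole_kernel x t s : Rcomplex R :=
  phase x t (s +i* eps) / (s +i* eps).

Let line_neq0 s : s +i* eps != 0 :> R[i].
Proof. by rewrite eq_complex /= (gt_eqF eps_gt0) andbF. Qed.

Let continuous_pole_kernel x t : continuous (pole_kernel x t).
Proof.
apply: is_derive_continuous => s.
(* 1 / z is written as conj z / |z|^2, a product of a differentiable complex factor and the real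
   factor [h]. *)
pose h (s : R) := (s ^+ 2 + eps ^+ 2)^-1.
have n0 (y : R) : y ^+ 2 + eps ^+ 2 != 0.
  by rewrite gt_eqF// ltr_wpDl ?sqr_ge0// exprn_gt0.
have dh : derivable h s 1 by apply: derivableV => //; exact: ex_derive.
have H := is_derive_mulc (is_derive_kernel_s 0 x t eps s)
  (is_derive_mulc (is_derive_line_Re (- eps) s) (is_derive_real_complex (derivableP dh))).
rewrite (_ : pole_kernel x t = fun y => kernel 0 x t eps y *
    ((y +i* (- eps)) * (h y)%:C) : Rcomplex R); first by eexists; exact: H.
apply/funext => y; rewrite /pole_kernel /kernel expr0 mul1r.
congr (_ * _); rewrite /h /GRing.inv /=.
by congr (_ +i* _); rewrite mulr0 (subr0, add0r) ?mulNr.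
Qed.

(** On the line |z| >= Im z = eps, so dividing by z costs at most a factor 1 / eps. *)
Let normc_pole_kernel x t s : 0 < t ->
  normc (pole_kernel x t s) <= kernel_bound 0 x t eps / eps / oneDsqr s.
Proof.
move=> t0; rewrite normcM normcV.
have eN : eps <= normc (s +i* eps).
  by apply: le_trans (abs_Im_le_normc _); exact: ler_norm.
have := normc_kernel_le 0 x s t0 eps_gt0; rewrite /kernel expr0 mul1r => h.
rewrite mulrAC; apply: ler_pM; rewrite ?normc_ge0 ?invr_ge0 ?normc_ge0//.
by rewrite lef_pV2 ?posrE// (lt_le_trans eps_gt0).
Qed.

Lemma integrable_pole_kernel x t : 0 < t -> Rcomplex_integrable (pole_kernel x t).
Proof.
move=> t0; apply: Rcomplex_integrable_le (@continuous_pole_kernel x t) _ => s.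
exact: normc_pole_kernel.
Qed.

(** Differentiating in t brings down i z^3, which cancels the pole and leaves i z^2; the i cancels
    the one in 3 / (2 pi i). *)
Lemma is_derive_v x t : 0 < t ->
  is_derive t 1 (v eps x : R -> Rcomplex R)
    (- (3 / (2 * pi%:C)) * kernel_integral 2 x t eps).
Proof.
move=> t0.
have h : is_derive t 1 (fun t => Rcomplex_integral (pole_kernel x t))
    (Rcomplex_integral (fun s => 'i%C * kernel 2 x t eps s)).
  apply: (@is_derive_Rcomplex_integral R (fun t => pole_kernel x t)
    (fun t s => 'i%C * kernel 2 x t eps s) (t / 2) (2 * t) _
    (kernel_unif 2 `|x| (t / 2) (2 * t) eps eps)).
  - by apply/andP; split; lra.
  - move=> y /andP[ty _]; apply: integrable_pole_kernel.
    by apply: lt_trans ty; rewrite divr_gt0.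
  - move=> y s _.
    have := is_derive_mulcl ((s +i* eps)^-1 : Rcomplex R)
      (is_derive_kernel_t 0 x y eps s).
    rewrite (_ : (fun y => _) = (fun y => pole_kernel x y s)); last first.
      by apply/funext => w; rewrite /kernel /pole_kernel expr0 mul1r mulrC.
    move=> /is_derive_eq; apply.
    have e (z a p : R[i]) : z != 0 -> z^-1 * (a * (z ^+ 3 * p)) = a * (z ^+ 2 * p).
      by move=> z0; field.
    exact: e (line_neq0 s).
  - move=> y s /andP[y1 y2]; rewrite normc_mulI.
    by apply: normc_kernel_unif; rewrite ?divr_gt0 ?lexx ?(ltW y1) ?(ltW y2).
have := is_derive_mulcl (- (3 / (2 * pi%:C * 'i%C)) : Rcomplex R) h.
rewrite Rcomplex_integralZl; last exact: integrable_kernel.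
move=> H; apply: (is_derive_eq H).
have e (a p J : R[i]) : a != 0 -> p != 0 ->
    - (3 / (2 * p * a)) * (a * J) = - (3 / (2 * p)) * J.
  by move=> a0 p0; field; rewrite a0 p0.
apply: e; rewrite eq_complex /= ?oner_eq0 ?andbF//.
by rewrite eqxx andbT gt_eqF// pi_gt0.
Qed.

(** Since (i z^3)^k z^2 = i^k z^(3k+2), this is the coefficient of J_(3k+2) in u_(k+1). *)
Definition u_coef k : Rcomplex R := - (3 / (2 * pi%:C)) * 'i%C ^+ k.

Let is_derive_mul_u_coef k x t : 0 < t ->
  is_derive t 1 (fun t => u_coef k * kernel_integral (3 * k + 2) x t eps : Rcomplex R)
    (u_coef k.+1 * kernel_integral (3 * k.+1 + 2) x t eps).
Proof.
move=> t0; apply: (is_derive_eq (is_derive_mulcl (u_coef k)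
  (is_derive_kernel_integral_t (3 * k + 2) x t0 eps_gt0))).
rewrite (_ : (3 * k.+1 + 2 = (3 * k + 2).+3)%N); last by lia.
have e (c a J : R[i]) : c * a ^+ k * (a * J) = c * a ^+ k.+1 * J.
  by rewrite exprS; ring.
exact: e.
Qed.

(** The induction hypothesis holds for all positive times, hence near [t], which suffices to
    differentiate it once more. *)
Lemma derive1n_vE k x t : 0 < t ->
  derive1n k.+1 (v eps x : R -> Rcomplex R) t =
  u_coef k * kernel_integral (3 * k + 2) x t eps.
Proof.
elim: k t => [|k IH] t t0.
  rewrite derive1n1 derive1E; have [_ ->] := is_derive_v x t0.
  by rewrite /u_coef expr0 mulr1 muln0 add0n.
rewrite derive1nS derive1E.
have [_ <-] := is_derive_mul_u_coef k x t0.
apply: near_eq_derive; near=> y; apply: IH.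
by near: y; exact: lt_nbhsr.
Unshelve. all: by end_near. Qed.

Lemma is_derive_derive1n_v k x t : 0 < t ->
  is_derive t 1 (derive1n k.+1 (v eps x : R -> Rcomplex R))
    (u_coef k.+1 * kernel_integral (3 * k.+1 + 2) x t eps).
Proof.
move=> t0; apply: near_eq_is_derive (is_derive_mul_u_coef k x t0).
near=> y; rewrite derive1n_vE//.
by near: y; exact: lt_nbhsr.
Unshelve. all: by end_near. Qed.

Let is_derive_mul_x (c : Rcomplex R) m x t : 0 < t ->
  is_derive x 1 (fun x => c * kernel_integral m x t eps : Rcomplex R)
    (c * 'i%C * kernel_integral m.+1 x t eps).
Proof.
move=> t0; apply: (is_derive_eq (is_derive_mulcl c
  (is_derive_kernel_integral_x m x t0 eps_gt0))).
exact: (mulrA c).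
Qed.

(** For fixed t > 0 the formula holds at every real x, so it is an equality of functions and can be
    iterated directly. *)
Let derive1n_mul_x (c : Rcomplex R) m t j : 0 < t ->
  derive1n j (fun x => c * kernel_integral m x t eps : Rcomplex R) =
  (fun x => c * 'i%C ^+ j * kernel_integral (m + j) x t eps).
Proof.
move=> t0; elim: j => [|j IH].
  by rewrite derive1n0 addn0; apply/funext => x; rewrite expr0 mulr1.
rewrite derive1nS IH; apply/funext => x; rewrite derive1E.
have [_ ->] := is_derive_mul_x (c * 'i%C ^+ j) (m + j) x t0.
by rewrite addnS exprSr mulrA.
Qed.

Let uE k t : 0 < t ->
  (fun x => u eps k.+1 x t) =
  (fun x => u_coef k * kernel_integral (3 * k + 2) x t eps).
Proof. by move=> t0; apply/funext => x; exact: derive1n_vE. Qed.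

Lemma solves_ibvp_u k : solves_ibvp (u eps k.+1).
Proof.
split.
- by move=> x t x0 t0; have [] := is_derive_derive1n_v k x t0.
- move=> t t0 j _ x _; rewrite uE// derive1n_mul_x//.
  by have [] := is_derive_mul_x (u_coef k * 'i%C ^+ j) (3 * k + 2 + j) x t0.
- move=> x t x0 t0; rewrite uE// derive1n_mul_x// derive1E.
  have [_ ->] := is_derive_derive1n_v k x t0.
  rewrite (_ : (3 * k.+1 + 2 = 3 * k + 2 + 3)%N); last by lia.
  (* Both sides are multiples of J_(3k+5), and the equation comes down to i^(k+1) = - i^k i^3. *)
  have e (c a J : R[i]) : a ^+ 2 = -1 -> c * a ^+ k.+1 * J = - (c * a ^+ k * a ^+ 3 * J).
    by move=> a2; rewrite [a ^+ 3]exprS a2 [a ^+ k.+1]exprS; ring.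
  by apply: e; exact: sqr_i.
- move=> t t0; rewrite uE//.
  have := cvg_mulcl (c := u_coef k) (cvg_kernel_integral_x (m := 3 * k + 2) t0 eps_gt0).
  by rewrite kernel_integral_at0// mulr0; exact.
- move=> x x0.
  have := cvg_mulcl (c := u_coef k) (cvg_kernel_integral_t (3 * k + 2) x0 eps_gt0).
  rewrite mulr0 => h; apply: cvg_trans (h _); apply: near_eq_cvg; near=> t.
  rewrite /u derive1n_vE//.
Unshelve. all: by end_near. Qed.

End the_solution.

Theorem mainTheorem4 (R : realType) (eps : R) (heps : 0 < eps) :
  [/\ (* v and its t-derivatives of all orders exist *)
      forall x t : R, 0 < x -> 0 < t ->
        line_integrable eps (fun z => phase x t z / z),
      forall (n : nat) (x : R), 0 < x ->
        derivable_upto n [set t | 0 < t] (v eps x : R -> Rcomplex R),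
      forall (n : nat) (x t : R), (1 <= n)%N -> 0 < x -> 0 < t ->
        let f := fun z : R[i] =>
          ('i%C * z ^+ 3) ^+ (n - 1) * phase x t z * z ^+ 2 in
        line_integrable eps f /\
        u eps n x t = - (3 / (2 * pi%:C)) * line_integral eps f,
      forall n : nat, (1 <= n)%N -> solves_ibvp (u eps n) &
      exists x t : R, [/\ 0 < x, 0 < t & u eps 1 x t <> 0]].
Proof.
have pole x t : 0 < t -> line_integrable eps (fun z => phase x t z / z).
  by move=> t0; exact: integrable_pole_kernel.
split.
- by move=> x t _; exact: pole.
- move=> n x x0 [|k] kn t t0; first by have [] := is_derive_v heps x t0.
  by have [] := is_derive_derive1n_v heps k x t0.
- move=> [//|k] x t _ x0 t0 f.
  have fE : (fun s => f (s +i* eps)) =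
      (fun s => 'i%C ^+ k * kernel (3 * k + 2) x t eps s).
    apply/funext => s; rewrite /f /kernel subn1 /=.
    have e (a z p : R[i]) : (a * z ^+ 3) ^+ k * p * z ^+ 2 =
        a ^+ k * (z ^+ (3 * k + 2) * p).
      by rewrite exprMn -exprM exprD; ring.
    exact: e.
  split.
    have := Rcomplex_integrableZl ('i%C ^+ k) (integrable_kernel (3 * k + 2) x t0 heps).
    by rewrite -fE.
  rewrite -[line_integral eps f]/(Rcomplex_integral (fun s => f (s +i* eps))) fE.
  rewrite Rcomplex_integralZl; last exact: integrable_kernel.
  by rewrite /u derive1n_vE// /u_coef mulrA.
- by move=> [//|k] _; exact: solves_ibvp_u.
- have [eta [eta0 J0]] := @kernel_integral_saddle_neq0 R.
  have t0 : 0 < (3 * eta)^-1 by rewrite invr_gt0 mulr_gt0.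
  exists eta, (3 * eta)^-1; split => //.
  (* The saddle estimate lives on the line Im z = eta; independence of the line carries it to Im z =
     eps. *)
  rewrite /u derive1n_vE// (kernel_integral_indep _ _ t0 heps eta0).
  move/eqP; rewrite /u_coef mulf_eq0 muln0 add0n (negbTE (introN eqP J0)) orbF.
  rewrite expr0 mulr1 oppr_eq0 mulf_eq0 invr_eq0 mulf_eq0 !pnatr_eq0 /=.
  by rewrite eq_complex /= eqxx andbT gt_eqF// pi_gt0.
Qed.
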